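(* Let the finite set $\mathcal C_{\mathrm{elig}}$ of eligible bid columns be partitioned as a disjoint union $\mathcal C_{\mathrm{elig}}=R\,\dot\cup\,D\,\dot\cup\,\mathcal U$ ($R$: admitted bids; $D$: revealed and quoted but unadmitted bids; $\mathcal U$: eligible but unrevealed bids). Let $Q_R=Q(R)$ be the exact optimal value of the restricted exchange problem with admitted set $R$, let $Q^\star_{\mathcal C}=Q(\mathcal C_{\mathrm{elig}})$ be the optimal value with every eligible column, and let $\lambda_R^\star$ be an exact optimal shadow price of the restricted problem. Then $$Q_R-Q^\star_{\mathcal C}\le\sum_{e\in D}\bar x_e\,\big[-(c_e-\lambda_R^{\star\top}a_e)\big]_+ +\sum_{e\in\mathcal U}\bar x_e\,\big[-(c_e-\lambda_R^{\star\top}a_e)\big]_+,$$ where $[u]_+=\max\{u,0\}$.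
   Context: Let $\mathcal K$ be a finite set of commodities, and let $\mathcal M^0$ be a finite set of incumbent firms. Agent $0$ (recourse) has cost $\tilde F_0(q)=\Phi(q)$ if $q\in\mathbb R_+^{|\mathcal K|}$ and $+\infty$ otherwise, where $\Phi:\mathbb R_+^{|\mathcal K|}\to\mathbb R$ is finite, closed, convex and componentwise nondecreasing. Each firm $m\in\mathcal M^0$ has a closed, proper, convex cost function $\tilde F_m:\mathbb R^{|\mathcal K|}\to(-\infty,+\infty]$ of its net injection. A bid column $e=(a_e,c_e,\bar x_e)$ has an injection vector $a_e\in\mathbb R_+^{|\mathcal K|}$ with nonempty support, a unit cost $c_e\ge0$ and a finite limit $\bar x_e>0$; as an agent it has cost $$\tilde F_e(q)=\inf_{0\le x\le\bar x_e}\{c_e x:q=a_e x\}$$ ($+\infty$ if no such $x$ exists). For a finite set $S$ of bids, let $\mathcal I_S=\{0\}\cup\mathcal M^0\cup S$ and $$Q(S)=\inf_{\{q_i\}}\Big\{\sum_{i\in\mathcal I_S}\tilde F_i(q_i):\sum_{i\in\mathcal I_S}q_i=0\Big\}.$$ Standing regularity assumption: every $\tilde F_i$ is closed, proper and convex, the exchange problem is feasible with finite optimal value, and its Lagrangian $\sum_i\tilde F_i(q_i)+y^\top\sum_iq_i$ admits a saddle point. An exact optimal shadow price is $\lambda=-y$, where $y$ is an optimal multiplier (the dual component of a saddle point). The quantity $c_e-\lambda^\top a_e$ is the reduced cost of $e$ at $\lambda$. *)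

(* Defs.v *)
From HB Require Import structures.
From mathcomp Require Import all_boot all_order all_algebra.
From mathcomp Require Import all_classical all_reals all_analysis.

Set Implicit Arguments.
Unset Strict Implicit.
Unset Printing Implicit Defensive.

Import Order.TTheory GRing.Theory Num.Theory.
Import numFieldNormedType.Exports.

Local Open Scope classical_set_scope.
Local Open Scope ring_scope.

(* Commodities are indexed by 'I_n, so that vectors of commodities
   are row vectors 'rV[R]_n. *)

Definition dotv (R : realType) (n : nat) (u v : 'rV[R]_n) : R :=
  \sum_(k < n) u 0 k * v 0 k.

Definition nonneg_vec (R : realType) (n : nat) (q : 'rV[R]_n) : Prop :=
  forall k : 'I_n, 0 <= q 0 k.

Section extended_functions.
Variables (R : realType) (n : nat).
Implicit Types f : 'rV[R]_n -> \bar R.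

Definition epigraph f : set ('rV[R]_n * R^o) :=
  [set p | (f p.1 <= (p.2 : R)%:E)%E].

Definition closed_fun f : Prop := closed (epigraph f).

Definition convex_fun f : Prop := convex_set (epigraph f).

Definition proper_fun f : Prop :=
  (forall q, (-oo < f q)%E) /\ (exists q, (f q < +oo)%E).

End extended_functions.

Record bid_column (R : realType) (n : nat) := BidColumn {
  bid_inj : 'rV[R]_n;
  bid_unit_cost : R;
  bid_limit : R;
  bid_inj_ge0 : nonneg_vec bid_inj;
  bid_inj_supp : exists k : 'I_n, bid_inj 0 k != 0;
  bid_unit_cost_ge0 : 0 <= bid_unit_cost;
  bid_limit_gt0 : 0 < bid_limit
}.

(* The infimum of the empty set is +oo. *)
Definition bid_cost (R : realType) (n : nat) (e : bid_column R n)
    (q : 'rV[R]_n) : \bar R :=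
  ereal_inf [set (bid_unit_cost e * x)%:E |
              x in [set x : R | 0 <= x <= bid_limit e /\ q = x *: bid_inj e]].

Definition reduced_cost (R : realType) (n : nat) (lam : 'rV[R]_n)
    (e : bid_column R n) : R :=
  bid_unit_cost e - dotv lam (bid_inj e).

(* The values of Phi outside the nonnegative orthant are irrelevant: Phi is
   meant as a finite function on the orthant, and its closedness and convexity
   are those of this extension, whose epigraph is the epigraph of Phi over the
   orthant. *)
Definition recourse_cost (R : realType) (n : nat) (Phi : 'rV[R]_n -> R)
    (q : 'rV[R]_n) : \bar R :=
  if `[< nonneg_vec q >] then (Phi q)%:E else +oo%E.

Definition nondecreasing_orthant (R : realType) (n : nat)
    (Phi : 'rV[R]_n -> R) : Prop :=
  forall p q : 'rV[R]_n, nonneg_vec p -> nonneg_vec q ->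
    (forall k : 'I_n, p 0 k <= q 0 k) -> Phi p <= Phi q.

(* None is the recourse agent 0, Some (inl m) an incumbent firm m,
   Some (inr e) the bid labelled e. *)
Definition agent (M E : finType) : finType := option (M + E)%type.

Section exchange.
Variables (R : realType) (n : nat) (M E : finType).
Variables (Phi : 'rV[R]_n -> R) (F : M -> 'rV[R]_n -> \bar R).
Variable bid : E -> bid_column R n.

Definition agent_cost (i : agent M E) : 'rV[R]_n -> \bar R :=
  match i with
  | None => recourse_cost Phi
  | Some (inl m) => F m
  | Some (inr e) => bid_cost (bid e)
  end.

Definition agents (S : {set E}) : {set agent M E} :=
  [set i : agent M E | if i is Some (inr e) then e \in S else true]%SET.

(* Allocations are families over all agents; only the components in agents S
   ever matter below. *)
Definition total_cost (S : {set E}) (q : agent M E -> 'rV[R]_n) : \bar R :=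
  (\sum_(i in agents S) agent_cost i (q i))%E.

Definition net_injection (S : {set E}) (q : agent M E -> 'rV[R]_n) : 'rV[R]_n :=
  \sum_(i in agents S) q i.

Definition exchange_value (S : {set E}) : \bar R :=
  ereal_inf [set total_cost S q | q in [set q | net_injection S q = 0]].

Definition lagrangian (S : {set E}) (q : agent M E -> 'rV[R]_n)
    (y : 'rV[R]_n) : \bar R :=
  (total_cost S q + (dotv y (net_injection S q))%:E)%E.

Definition saddle_point (S : {set E}) (q : agent M E -> 'rV[R]_n)
    (y : 'rV[R]_n) : Prop :=
  (forall y', (lagrangian S q y' <= lagrangian S q y)%E) /\
  (forall q', (lagrangian S q y <= lagrangian S q' y)%E).

Definition optimal_multiplier (S : {set E}) (y : 'rV[R]_n) : Prop :=
  exists q, saddle_point S q y.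

Definition optimal_shadow_price (S : {set E}) (lam : 'rV[R]_n) : Prop :=
  exists2 y, optimal_multiplier S y & lam = - y.

Definition exchange_feasible (S : {set E}) : Prop :=
  exists2 q, net_injection S q = 0 & (total_cost S q < +oo)%E.

Definition regular_exchange (S : {set E}) : Prop :=
  [/\ forall i, i \in agents S ->
        [/\ closed_fun (agent_cost i), proper_fun (agent_cost i)
          & convex_fun (agent_cost i)],
      exchange_feasible S,
      exchange_value S \is a fin_num
    & exists q y, saddle_point S q y].

End exchange.

(* Main.v *)
Require Import Defs.
From HB Require Import structures.
From mathcomp Require Import all_boot all_order all_algebra.
From mathcomp Require Import all_classical all_reals all_analysis.
From mathcomp Require Import lra.
Import Order.TTheory GRing.Theory Num.Theory.
Import numFieldNormedType.Exports.
Local Open Scope ring_scope.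

(* Lagrangian duality: a saddle multiplier y = - lam of the restricted problem
   gives [Q_R <= L_R(q, y)] for every allocation q.  The Lagrangian is separable,
   so over an allocation balanced for all eligible columns the total cost is
   [L_R(q, y)] plus the contributions [bid_cost e q_e + y . q_e] of the
   unadmitted columns, and each of these is a flow [0 <= x <= bid_limit e] times
   the reduced cost, hence at least [- bid_limit e * [- reduced_cost e]_+]. *)

Set Implicit Arguments.
Unset Strict Implicit.
Unset Printing Implicit Defensive.

Section dot_product.
Context {R : realType} {n : nat}.
Implicit Types u v w : 'rV[R]_n.

Lemma dotv0 u : dotv u 0 = 0.
Proof. by rewrite /dotv big1 // => k _; rewrite mxE mulr0. Qed.

Lemma dotvZr (x : R) u v : dotv u (x *: v) = x * dotv u v.
Proof. by rewrite /dotv mulr_sumr; apply: eq_bigr => k _; rewrite mxE mulrCA. Qed.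

Lemma dotvNl u v : dotv (- u) v = - dotv u v.
Proof. by rewrite /dotv -sumrN; apply: eq_bigr => k _; rewrite mxE mulNr. Qed.

Lemma dotvDl u v w : dotv (u + v) w = dotv u w + dotv v w.
Proof. by rewrite /dotv -big_split; apply: eq_bigr => k _; rewrite mxE mulrDl. Qed.

Lemma dotv_sumr (I : finType) (P : pred I) (f : I -> 'rV[R]_n) u :
  dotv u (\sum_(i | P i) f i) = \sum_(i | P i) dotv u (f i).
Proof.
rewrite /dotv exchange_big; apply: eq_bigr => k _.
by rewrite summxE mulr_sumr.
Qed.

(** A sum of squares that is at most zero has only zero terms. This serves to show that a saddle
    point is balanced. *)
Lemma dotvv_le0 u : dotv u u <= 0 -> u = 0.
Proof.
move=> uu_le0; apply/rowP => k; rewrite mxE.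
have sq_ge0 (j : 'I_n) : true -> 0 <= u 0 j * u 0 j by rewrite -expr2 sqr_ge0.
have uu0 : dotv u u = 0 by apply/le_anti; rewrite uu_le0 sumr_ge0.
have /eqP := psumr_eq0P sq_ge0 uu0 (i := k) isT.
by rewrite mulf_eq0 orbb => /eqP.
Qed.

End dot_product.

(** A feasible flow [x] contributes [x] times the reduced cost, which is smallest at an endpoint of
    the interval from 0 to [bid_limit e]. If no flow produces [q], the cost is [+oo] and the bound
    is trivial. *)
Lemma bid_profit_bound (R : realType) (n : nat) (e : bid_column R n)
    (lam q : 'rV[R]_n) :
  ((- (bid_limit e * Num.max (- reduced_cost lam e) 0))%:E
   <= bid_cost e q + (dotv (- lam) q)%:E)%E.
Proof.
rewrite -leeBlDr // -EFinB; apply: le_ereal_inf_tmp => _ [x [/andP[x0 xl] ->] <-].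
rewrite lee_fin dotvZr dotvNl mulrN opprK /reduced_cost.
set a := dotv _ _; set c := bid_unit_cost e; set m := Num.max _ _.
have m_ge0 : 0 <= m by rewrite le_max lexx orbT.
have m_ge : - (c - a) <= m by rewrite le_max lexx.
(* The chain is [x * - (c - a) <= x * m <= bid_limit e * m]. *)
have := ler_wpM2l x0 m_ge; have := ler_wpM2r m_ge0 xl.
by move: (bid_limit e) => l; lra.
Qed.

Lemma big_setU_disjoint (T : Type) (idx : T) (op : Monoid.com_law idx)
    (I : finType) (A B : {set I}) (f : I -> T) : [disjoint A & B] ->
  \big[op/idx]_(i in A :|: B) f i =
  op (\big[op/idx]_(i in A) f i) (\big[op/idx]_(i in B) f i).
Proof.
by move=> dAB; rewrite -bigU //; apply: eq_bigl => i; rewrite !inE.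
Qed.

Section exchange_theory.
Context {R : realType} {n : nat} {M E : finType}.
Variables (Phi : 'rV[R]_n -> R) (F : M -> 'rV[R]_n -> \bar R).
Variable bid : E -> bid_column R n.
Implicit Types (S T : {set E}) (q : agent M E -> 'rV[R]_n) (y : 'rV[R]_n).

Local Notation agent_cost := (agent_cost Phi F bid).
Local Notation total_cost := (total_cost Phi F bid).
Local Notation lagrangian := (lagrangian Phi F bid).
Local Notation exchange_value := (exchange_value Phi F bid).

Lemma lagrangian_sum S q y :
  lagrangian S q y =
  (\sum_(i in agents M S) (agent_cost i (q i) + (dotv y (q i))%:E))%E.
Proof.
by rewrite /lagrangian /net_injection dotv_sumr -sumEFin /total_cost big_split.
Qed.

Lemma lagrangian_balanced S q y :
  net_injection S q = 0 -> lagrangian S q y = total_cost S q.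
Proof. by rewrite /lagrangian => ->; rewrite dotv0 adde0. Qed.

Lemma lagrangianU S T q y : [disjoint S & T] ->
  lagrangian (S :|: T)%SET q y =
  (lagrangian S q y + \sum_(e in T)
     (bid_cost (bid e) (q (Some (inr e))) + (dotv y (q (Some (inr e))))%:E))%E.
Proof.
move=> dST.
(* Enlarging [S] by [T] adds exactly the image of [T] under [inj] to the agents, so the separable
   sum splits along it. *)
pose inj (e : E) : agent M E := Some (inr e).
have inj_inj : injective inj by move=> e e' [].
have agentsU : agents M (S :|: T) = (agents M S :|: inj @: T)%SET.
  apply/setP => -[[m|e]|]; rewrite !inE //=.
  by rewrite -[Some _]/(inj e) (mem_imset _ _ inj_inj).
have dis : [disjoint agents M S & inj @: T].
  rewrite disjoint_sym; apply/pred0P => i /=; apply/negP => /andP[/imsetP[e eT ->]].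
  by rewrite inE => eS; have := disjointFr dST eS; rewrite eT.
rewrite !lagrangian_sum agentsU (big_setU_disjoint _ _ dis) /=; congr (_ + _)%E.
by rewrite big_imset //= => e e' _ _ /inj_inj.
Qed.

Lemma total_cost_gtNy S q :
  (forall i, i \in agents M S -> proper_fun (agent_cost i)) ->
  (-oo < total_cost S q)%E.
Proof.
move=> prop; rewrite ltNye; apply/eqP => /esum_eqNyP[i [_ iS /eqP]].
by have [/(_ (q i))] := prop i iS; rewrite ltNye => /negbTE ->.
Qed.

(** The primal part of a saddle point has finite cost and is balanced, so it competes in the infimum
    and its Lagrangian equals its cost. *)
Lemma saddle_value S q y : regular_exchange Phi F bid S ->
  saddle_point Phi F bid S q y -> (exchange_value S <= lagrangian S q y)%E.
Proof.
move=> [reg [p p0 p_fin] _ _] [max_y min_q].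
have lo : (-oo < total_cost S q)%E.
  by apply: total_cost_gtNy => i /reg[].
(* Minimality of [q] against the feasible [p] bounds the Lagrangian below [+oo]; its linear term is
   finite, so the cost is below [+oo] too. *)
have up : (total_cost S q < +oo)%E.
  have := le_lt_trans (min_q p); rewrite (lagrangian_balanced _ p0) => /(_ _ p_fin).
  by rewrite /Defs.lagrangian !ltey; apply: contra_neq => ->; rewrite addye.
(* Finiteness is what allows the cost to be cancelled from both sides of the maximality inequality
   below. *)
have tfin : total_cost S q \is a fin_num by rewrite fin_real // lo up.
(* Moving the multiplier along the net injection would raise the Lagrangian. *)
have q0 : net_injection S q = 0.
  apply: dotvv_le0; have := max_y (y + net_injection S q).
  by rewrite /Defs.lagrangian leeD2lE // lee_fin dotvDl gerDl.
by rewrite (lagrangian_balanced _ q0); apply: ereal_inf_lbound; exists q.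
Qed.

Lemma exchange_value_setU S T (lam : 'rV[R]_n) :
  regular_exchange Phi F bid S -> optimal_shadow_price Phi F bid S lam ->
  [disjoint S & T] ->
  (exchange_value S
     - (\sum_(e in T)
          bid_limit (bid e) * Num.max (- reduced_cost lam (bid e)) 0)%:E
   <= exchange_value (S :|: T)%SET)%E.
Proof.
move=> reg [y [qb sad] lamE] dST.
apply: le_ereal_inf_tmp => _ [q q0 <-].
rewrite -(lagrangian_balanced y q0) lagrangianU //.
apply: leeD.
  (* Minimality in the saddle point ranges over all allocations, so it covers [q], which is balanced
     for the union but perhaps not for [S]. *)
  by apply: le_trans (saddle_value reg sad) _; case: sad.
rewrite -EFinN -sumrN -sumEFin; apply: lee_sum => e _.
have -> : y = - lam by rewrite lamE opprK.
exact: bid_profit_bound.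
Qed.

End exchange_theory.

Theorem propositionS3p2 (R : realType) (n : nat) (M E : finType)
  (Phi : 'rV[R]_n -> R) (F : M -> 'rV[R]_n -> \bar R)
  (bid : E -> bid_column R n)
  (Phi_closed : closed_fun (recourse_cost Phi))
  (Phi_convex : convex_fun (recourse_cost Phi))
  (Phi_nondecreasing : nondecreasing_orthant Phi)
  (F_closed : forall m : M, closed_fun (F m))
  (F_proper : forall m : M, proper_fun (F m))
  (F_convex : forall m : M, convex_fun (F m))
  (Celig Radm D U : {set E})
  (Celig_cover : Celig = (Radm :|: D :|: U)%SET)
  (disjoint_RD : [disjoint Radm & D])
  (disjoint_RU : [disjoint Radm & U])
  (disjoint_DU : [disjoint D & U])
  (regular_R : regular_exchange Phi F bid Radm)
  (regular_C : regular_exchange Phi F bid Celig)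
  (lamR : 'rV[R]_n)
  (lamR_opt : optimal_shadow_price Phi F bid Radm lamR) :
  (exchange_value Phi F bid Radm - exchange_value Phi F bid Celig <=
   (\sum_(e in D)
       bid_limit (bid e) * Num.max (- reduced_cost lamR (bid e)) 0
    + \sum_(e in U)
       bid_limit (bid e) * Num.max (- reduced_cost lamR (bid e)) 0)%:E)%E.
Proof.
have dis : [disjoint Radm & D :|: U].
  by rewrite -finset.setI_eq0 finset.setIUr finset.setU_eq0 !finset.setI_eq0 disjoint_RD.
have := exchange_value_setU regular_R lamR_opt dis.
have [_ _ finC _] := regular_C.
rewrite finset.setUA -Celig_cover (big_setU_disjoint _ _ disjoint_DU) /= => bound.
(* The two subtracted terms trade sides, which is legitimate in the extended reals because [finC]
   makes the full optimal value finite. *)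
by rewrite leeBlDr // addeC -leeBlDr.
Qed.
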